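(* Let $G$ be a game structure with state space $S$ and let $i\in\{1,2\}$. Let $d_0=d'_0=b_0=b'_0=\mathbf{0}$ (the constant zero function on $S\times S$), and for $n\ge0$ let $d_{n+1}=H_{\preceq_i}(d_n)$, $d'_{n+1}=H_{\sqsubseteq_i}(d'_n)$, $b_{n+1}=H_{\preceq_i}(b_n)\sqcup\breve{H_{\preceq_i}(b_n)}$ and $b'_{n+1}=H_{\sqsubseteq_i}(b'_n)\sqcup\breve{H_{\sqsubseteq_i}(b'_n)}$. Then $\lim_{n\to\infty}d_n=[\preceq_i]$, $\lim_{n\to\infty}d'_n=[\sqsubseteq_i]$, $\lim_{n\to\infty}b_n=[\simeq_i]$ and $\lim_{n\to\infty}b'_n=[\cong_i]$ (pointwise).
   Context: A game structure $G=(S,[\cdot],\mathit{Moves},\Gamma_1,\Gamma_2,\delta)$: finite state set $S$; finite set $V$ of observation variables, each $v$ interpreted as $[v]:S\to[0,1]$; finite move set; $\Gamma_1,\Gamma_2:S\to2^{\mathit{Moves}}\setminus\{\emptyset\}$; $\delta:S\times\mathit{Moves}\times\mathit{Moves}\to\mathrm{Distr}(S)$. For player $i$, $\bar i=3-i$. Mixed moves $\mathcal{D}_i(s)=\mathrm{Distr}(\Gamma_i(s))$; $\delta(s,x_1,x_2)(u)=\sum_{a_1,a_2}\delta(s,a_1,a_2)(u)x_1(a_1)x_2(a_2)$, where $x_1$ is player 1's and $x_2$ player 2's mixed move. Valuations are $k:S\to[0,1]$; $\mathrm{E}^{x_1,x_2}_s(k)=\sum_u\delta(s,x_1,x_2)(u)k(u)$;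 $\mathrm{Pre}_i(k)(s)=\sup_{x_i\in\mathcal{D}_i(s)}\inf_{x_{\bar i}\in\mathcal{D}_{\bar i}(s)}\mathrm{E}^{x_1,x_2}_s(k)$. A directed metric is $d:S\times S\to\mathbb{R}_{\ge0}$ with $d(s,s)=0$ and $d(s,t)\le d(s,u)+d(u,t)$; the set of directed metrics is ordered pointwise; $\breve d(s,t)=d(t,s)$; $\sqcup=\max$ (pointwise). $C(d)=\{k:k(s)-k(t)\le d(s,t)\ \forall s,t\}$; $[s\equiv t]=\max_{v\in V}|[v](s)-[v](t)|$. A priori transformer: $H_{\preceq_i}(d)(s,t)=[s\equiv t]\sqcup\sup_{k\in C(d)}(\mathrm{Pre}_i(k)(s)-\mathrm{Pre}_i(k)(t))$. A posteriori transformer: $H_{\sqsubseteq_i}(d)(s,t)=[s\equiv t]\sqcup\sup_{x_i\in\mathcal{D}_i(s)}\inf_{y_i\in\mathcal{D}_i(t)}\sup_{y_{\bar i}\in\mathcal{D}_{\bar i}(t)}\inf_{x_{\bar i}\in\mathcal{D}_{\bar i}(s)}\sup_{k\in C(d)}(\mathrm{E}^{x_1,x_2}_s(k)-\mathrm{E}^{y_1,y_2}_t(k))$. The a priori simulation metric $[\preceq_i]$ is the least fixpoint of $H_{\preceq_i}$ and the a priori bisimulation metric $[\simeq_i]$ is the least symmetrical fixpoint of $H_{\preceq_i}$ (the least fixpoint of $d\mapsto H_{\preceq_i}(d)\sqcup\breve{H_{\preceq_i}(d)}$); the a posteriori simulation metric $[\sqsubseteq_i]$ and bisimulation metric $[\cong_i]$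 are defined in the same way from $H_{\sqsubseteq_i}$. Fixpoints are taken in the pointwise-ordered lattice of directed metrics on $S$. *)

(* Defs.v *)
From HB Require Import structures.
From mathcomp Require Import all_boot all_order all_algebra.
From mathcomp Require Import all_classical all_reals all_analysis.

Set Implicit Arguments.
Unset Strict Implicit.
Unset Printing Implicit Defensive.

Import Order.TTheory GRing.Theory Num.Theory.
Import numFieldNormedType.Exports.

Local Open Scope classical_set_scope.
Local Open Scope ring_scope.

Inductive player := Player1 | Player2.

Definition opponent (i : player) : player :=
  match i with Player1 => Player2 | Player2 => Player1 end.

(* Distr(A) for A a subset of T, as functions on T vanishing outside A. *)
Definition distr (R : realType) (T : finType) (A : {pred T}) : set (T -> R) :=
  [set x | [/\ forall a, 0 <= x a,
               forall a, a \notin A -> x a = 0 &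
               \sum_a x a = 1]].

Record game_structure (R : realType) (S V Moves : finType) := GameStructure {
  obs : V -> S -> R;
  obs_itv : forall v s, 0 <= obs v s <= 1;
  avail : player -> S -> {set Moves};
  avail_neq0 : forall i s, exists a, a \in avail i s;
  delta : S -> Moves -> Moves -> S -> R;
  delta_distr : forall s a1 a2, distr predT (delta s a1 a2)
}.

Section Game.
Variables (R : realType) (S V Moves : finType).
Variable G : game_structure R S V Moves.

Definition mixed (i : player) (s : S) : set (Moves -> R) := distr (avail G i s).

Definition mixed_delta (s : S) (x1 x2 : Moves -> R) (u : S) : R :=
  \sum_a1 \sum_a2 delta G s a1 a2 u * x1 a1 * x2 a2.

Definition expect (s : S) (x1 x2 : Moves -> R) (k : S -> R) : R :=
  \sum_u mixed_delta s x1 x2 u * k u.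

(* Here [x] is the mixed move of player [i] and [y] that of the opponent of
   [i]; [expect] takes the move of player 1 first. *)
Definition expect_for (i : player) (s : S) (x y : Moves -> R) (k : S -> R) : R :=
  match i with
  | Player1 => expect s x y k
  | Player2 => expect s y x k
  end.

Definition Pre (i : player) (k : S -> R) (s : S) : R :=
  sup [set inf [set expect_for i s x y k | y in mixed (opponent i) s]
      | x in mixed i s].

Definition valuation : set (S -> R) := [set k | forall s, 0 <= k s <= 1].

Definition C_of (d : S -> S -> R) : set (S -> R) :=
  [set k | valuation k /\ forall s t, k s - k t <= d s t].

Definition obs_dist (s t : S) : R :=
  \big[Num.max/0]_(v : V) `|obs G v s - obs G v t|.

(* In both transformers every [sup] and [inf] is over a nonempty bounded set
   whenever [d] is nonnegative, so the junk value of [sup] is never reached. *)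
Definition H_apriori (i : player) (d : S -> S -> R) (s t : S) : R :=
  Num.max (obs_dist s t) (sup [set Pre i k s - Pre i k t | k in C_of d]).

Definition H_aposteriori (i : player) (d : S -> S -> R) (s t : S) : R :=
  Num.max (obs_dist s t)
    (sup [set
       inf [set
         sup [set
           inf [set
             sup [set expect_for i s x x' k - expect_for i t y y' k | k in C_of d]
           | x' in mixed (opponent i) s]
         | y' in mixed (opponent i) t]
       | y in mixed i t]
     | x in mixed i s]).

End Game.

Section Metrics.
Variables (R : realType) (S : finType).
Implicit Types (d : S -> S -> R) (H : (S -> S -> R) -> S -> S -> R).

Definition directed_metric d : Prop :=
  [/\ forall s t, 0 <= d s t,
      forall s, d s s = 0 &
      forall s t u, d s t <= d s u + d u t].

Definition converse d : S -> S -> R := fun s t => d t s.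

Definition join d d' : S -> S -> R := fun s t => Num.max (d s t) (d' s t).

Definition symmetrize H : (S -> S -> R) -> S -> S -> R :=
  fun d => join (H d) (converse (H d)).

Definition zero_metric : S -> S -> R := fun _ _ => 0.

Definition is_least_fixpoint H d : Prop :=
  [/\ directed_metric d,
      H d = d &
      forall d', directed_metric d' -> H d' = d' -> forall s t, d s t <= d' s t].

(* The least fixpoint of H among directed metrics if there is one (it is unique
   by antisymmetry), and the zero function otherwise. *)
Definition least_fixpoint H : S -> S -> R :=
  xget zero_metric [set d | is_least_fixpoint H d].

Definition iterates H (n : nat) : S -> S -> R := iter n H zero_metric.

Definition pointwise_limit (u : nat -> S -> S -> R) d : Prop :=
  forall s t, (fun n => u n s t) @ \oo --> d s t.

End Metrics.

Section GameMetrics.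
Variables (R : realType) (S V Moves : finType).
Variables (G : game_structure R S V Moves) (i : player).

Definition apriori_sim : S -> S -> R := least_fixpoint (H_apriori G i).
Definition apriori_bisim : S -> S -> R :=
  least_fixpoint (symmetrize (H_apriori G i)).
Definition aposteriori_sim : S -> S -> R := least_fixpoint (H_aposteriori G i).
Definition aposteriori_bisim : S -> S -> R :=
  least_fixpoint (symmetrize (H_aposteriori G i)).

End GameMetrics.

(* Main.v *)
Require Import Defs.
From mathcomp Require Import all_boot all_order all_algebra.
From mathcomp Require Import all_classical all_reals all_analysis.
From mathcomp Require Import lra.

(** All four transformers map directed metrics to directed metrics bounded by 1
    and are nonexpansive: [d <= d' + e] implies [H d <= H d' + e]. Nonexpansiveness
    rests on one construction: if [k] is in [C(d)], then
    [k'(s) = min_t (k(t) + d'(s,t))] is in [C(d')] and [k - e <= k' <= k].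
    With [e = 0] this gives monotonicity, so the iterates from zero increase to a
    limit; with [e > 0], and since convergence is uniform on the finite set
    [S * S], it shows that this limit is a fixpoint, and it lies below every
    other one. *)

Set Implicit Arguments.
Unset Strict Implicit.
Unset Printing Implicit Defensive.

Import Order.TTheory GRing.Theory Num.Theory.
Import numFieldNormedType.Exports.

Local Open Scope classical_set_scope.
Local Open Scope ring_scope.

(** * Suprema and infima of bounded families of reals *)

Section SupInfImage.
Variables (R : realType) (T : Type) (A : set T).
Hypothesis A0 : A !=set0.
Implicit Types (f g : T -> R) (a b c e : R).

Lemma sup_image_le f c :
  (forall x, A x -> f x <= c) -> sup [set f x | x in A] <= c.
Proof.
move=> h; apply: ge_sup; last by move=> _ [x Ax <-]; exact: h.
by case: A0 => x Ax; exists (f x), x.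
Qed.

Lemma le_inf_image f c :
  (forall x, A x -> c <= f x) -> c <= inf [set f x | x in A].
Proof.
move=> h; apply: lb_le_inf; last by move=> _ [x Ax <-]; exact: h.
by case: A0 => x Ax; exists (f x), x.
Qed.

Lemma le_sup_image f a b x : (forall z, A z -> a <= f z <= b) -> A x ->
  f x <= sup [set f z | z in A].
Proof.
move=> h Ax; apply: ub_le_sup; last by exists x.
by exists b => _ [z Az <-]; have /andP[] := h z Az.
Qed.

Lemma inf_image_le f a b x : (forall z, A z -> a <= f z <= b) -> A x ->
  inf [set f z | z in A] <= f x.
Proof.
move=> h Ax; apply: ge_inf; last by exists x.
by exists a => _ [z Az <-]; have /andP[] := h z Az.
Qed.

Lemma inf_image_adherent f a b e : (forall z, A z -> a <= f z <= b) -> 0 < e ->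
  exists2 x, A x & f x < inf [set f z | z in A] + e.
Proof.
move=> h e0; have hi : has_inf [set f z | z in A].
  split; first by case: A0 => x Ax; exists (f x), x.
  by exists a => _ [z Az <-]; have /andP[] := h z Az.
by have [_ [x Ax <-] lt] := inf_adherent e0 hi; exists x.
Qed.

Lemma sup_image_itv f a b : (forall z, A z -> a <= f z <= b) ->
  a <= sup [set f z | z in A] <= b.
Proof.
move=> h; apply/andP; split; last by apply: sup_image_le => x /h/andP[].
have [x Ax] := A0; have /andP[ax _] := h x Ax.
exact: le_trans ax (le_sup_image h Ax).
Qed.

Lemma inf_image_itv f a b : (forall z, A z -> a <= f z <= b) ->
  a <= inf [set f z | z in A] <= b.
Proof.
move=> h; apply/andP; split; first by apply: le_inf_image => x /h/andP[].
have [x Ax] := A0; have /andP[_ xb] := h x Ax.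
exact: le_trans (inf_image_le h Ax) xb.
Qed.

(** The bounds are put on the family [g], whose [sup] must be a genuine upper bound; in the dual
    statement for [inf] they are put on [f]. *)
Lemma sup_image_leD f g a b e : (forall z, A z -> a <= g z <= b) ->
  (forall z, A z -> f z <= g z + e) ->
  sup [set f z | z in A] <= sup [set g z | z in A] + e.
Proof.
move=> hg fg; apply: sup_image_le => x Ax; apply: le_trans (fg x Ax) _.
by rewrite lerD2r; exact: le_sup_image hg Ax.
Qed.

Lemma inf_image_leD f g a b e : (forall z, A z -> a <= f z <= b) ->
  (forall z, A z -> f z <= g z + e) ->
  inf [set f z | z in A] <= inf [set g z | z in A] + e.
Proof.
move=> hf fg; rewrite -lerBlDr; apply: le_inf_image => x Ax.
rewrite lerBlDr; apply: le_trans (fg x Ax); exact: inf_image_le hf Ax.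
Qed.

End SupInfImage.

(** * Least fixpoints as limits of iterates *)

Section LeastFixpoint.
Variables (R : realType) (S : finType).
Implicit Types (d : S -> S -> R) (H : (S -> S -> R) -> S -> S -> R).

Definition bounded_nonexpansive H : Prop :=
  [/\ forall d, directed_metric d -> directed_metric (H d),
      forall d, directed_metric d -> forall s t, H d s t <= 1 &
      forall d d' e, directed_metric d -> directed_metric d' -> 0 <= e ->
        (forall s t, d s t <= d' s t + e) ->
        forall s t, H d s t <= H d' s t + e].

Lemma directed_metric_zero : directed_metric (@zero_metric R S).
Proof. by split=> // *; rewrite /zero_metric addr0. Qed.

Lemma symmetrize_bounded_nonexpansive H :
  bounded_nonexpansive H -> bounded_nonexpansive (symmetrize H).
Proof.
case=> dH H1 nH; rewrite /symmetrize /join /converse; split.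
- move=> d /dH[p z tr]; split=> [s t|s|s t u].
  + by rewrite le_max p.
  + by rewrite z maxxx.
  + rewrite ge_max; apply/andP; split.
      by apply: le_trans (tr s t u) _; rewrite lerD// le_max lexx.
    (* The converse runs the path backwards, from [t] through [u] to [s], so the two summands come
       in the opposite order. *)
    apply: le_trans (tr t s u) _.
    by rewrite addrC lerD// le_max lexx orbT.
- by move=> d dd s t; rewrite ge_max !H1.
- move=> d d' e dd dd' e0 le s t; rewrite ge_max; apply/andP; split.
    by apply: le_trans (nH d d' e dd dd' e0 le _ _) _; rewrite lerD2r le_max lexx.
  apply: le_trans (nH d d' e dd dd' e0 le _ _) _.
  by rewrite lerD2r le_max lexx orbT.
Qed.

(** A witness [d] rules out the default value of [xget], and antisymmetry identifies the chosen
    fixpoint with [d]. *)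
Lemma least_fixpoint_eq H d : is_least_fixpoint H d -> least_fixpoint H = d.
Proof.
move=> hd; have : is_least_fixpoint H (least_fixpoint H).
  by rewrite /least_fixpoint; case: xgetP => [x -> //|/(_ d)].
case: hd => dd fd ld [dd' fd' ld'].
by apply/funext => s; apply/funext => t; apply/le_anti; rewrite ld ?ld'.
Qed.

Section Iterates.
Variables (H : (S -> S -> R) -> S -> S -> R).
Hypothesis hH : bounded_nonexpansive H.

Let u := iterates H.
Let dm n : directed_metric (u n).
Proof.
case: hH => dH _ _.
by elim: n => [|n ih]; [exact: directed_metric_zero | exact: dH].
Qed.

Let mono d d' : directed_metric d -> directed_metric d' ->
  (forall s t, d s t <= d' s t) -> forall s t, H d s t <= H d' s t.
Proof.
case: hH => _ _ nH dd dd' le s t; rewrite -[leRHS]addr0.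
by apply: nH => // s' t'; rewrite addr0.
Qed.

Let u_step n s t : u n s t <= u n.+1 s t.
Proof.
elim: n s t => [|n ih] s t; first by case: (dm 1).
exact: (mono (dm n) (dm n.+1) ih).
Qed.

Let u_nd s t : nondecreasing_seq (fun n => u n s t).
Proof. by apply/nondecreasing_seqP => n; exact: u_step. Qed.

Let u_le1 n s t : u n s t <= 1.
Proof. case: hH => _ H1 _; case: n => [|n]; [exact: ler01 | exact: H1]. Qed.

Let u_cvg s t : cvgn (fun n => u n s t).
Proof.
apply: nondecreasing_is_cvgn; first exact: u_nd.
by exists 1 => _ [n _ <-]; exact: u_le1.
Qed.

Let d : S -> S -> R := fun s t => limn (fun n => u n s t).

Let u_le_d n s t : u n s t <= d s t.
Proof. by have := nondecreasing_cvgn_le (u_nd s t) (@u_cvg s t) n. Qed.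

Let d_le s t c : (forall n, u n s t <= c) -> d s t <= c.
Proof. by move=> h; apply: limr_le; [exact: u_cvg | exact: nearW]. Qed.

Let dm_d : directed_metric d.
Proof.
split=> [s t|s|s t v].
- exact: (u_le_d 0).
- apply/le_anti; rewrite (u_le_d 0) andbT; apply: d_le => n.
  by case: (dm n) => _ ->.
- apply: d_le => n; case: (dm n) => _ _ tr.
  by apply: le_trans (tr s t v) _; rewrite lerD ?u_le_d.
Qed.

(** The largest of the finitely many pointwise thresholds works for all pairs, because the iterates
    increase. *)
Let approx e : 0 < e -> exists n, forall s t, d s t <= u n s t + e.
Proof.
move=> e0; have ex (p : S * S) : exists n, d p.1 p.2 <= u n p.1 p.2 + e.
  apply: contrapT => /forallNP h.
  (* If every [n] failed, [d - e] would bound all iterates at [p], hence also their limit. *)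
  suff : d p.1 p.2 <= d p.1 p.2 - e by move=> ?; lra.
  by apply: d_le => n; have /negP := h n; rewrite -ltNge => ?; lra.
have [N hN] := choice ex.
exists (\max_p N p) => s t; apply: le_trans (hN (s, t)) _.
by rewrite lerD2r; apply: u_nd; exact: leq_bigmax.
Qed.

(** The first conjunct records that [least_fixpoint H] is not the default value of its
    definition. *)
Lemma iterates_cvg_least_fixpoint :
  is_least_fixpoint H (least_fixpoint H) /\
  pointwise_limit (iterates H) (least_fixpoint H).
Proof.
have lfp : is_least_fixpoint H d.
  split=> //.
    apply/funext => s; apply/funext => t; apply/le_anti/andP; split.
      (* From [d <= u n + e] follows [H d <= u n.+1 + e <= d + e], for every positive [e]. *)
      apply/ler_addgt0Pr => e e0; have [n hn] := approx e0.
      have [_ _ nH] := hH.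
      apply: le_trans (nH _ _ e dm_d (dm n) (ltW e0) hn s t) _.
      by rewrite lerD2r; exact: (u_le_d n.+1).
    (* Conversely [u n <= u n.+1 = H (u n) <= H d] by monotonicity. *)
    apply: d_le => n; apply: le_trans (u_step n s t) _.
    by apply: mono => // *; exact: u_le_d.
  move=> d' dd' fd' s t; apply: d_le => n.
  elim: n s t => [|n ih] s t; first by case: dd'.
  by rewrite -fd'; exact: mono.
by rewrite (least_fixpoint_eq lfp); split=> // s t; exact: u_cvg.
Qed.

End Iterates.
End LeastFixpoint.

(** * Mixed moves, expectations and [Pre] *)

Section GameTransformers.
Variables (R : realType) (S V Moves : finType).
Variables (G : game_structure R S V Moves) (i : player).
Implicit Types (d : S -> S -> R) (k : S -> R) (x y : Moves -> R).

Lemma mixed_neq0 (j : player) s : mixed G j s !=set0.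
Proof.
(* The witness is the point mass at an available move. *)
have [a ha] := avail_neq0 G j s; exists (fun b => (b == a)%:R); split.
- by move=> b; rewrite ler0n.
- by move=> b; apply: contraNeq; rewrite pnatr_eq0 eqb0 negbK => /eqP->.
- by rewrite (bigD1 a)//= eqxx big1 ?addr0// => b /negPf ->.
Qed.

Lemma mixed_delta_distr (j1 j2 : player) s x1 x2 :
  mixed G j1 s x1 -> mixed G j2 s x2 -> distr predT (mixed_delta G s x1 x2).
Proof.
move=> [p1 _ s1] [p2 _ s2]; split=> //.
  move=> v; apply: sumr_ge0 => a1 _; apply: sumr_ge0 => a2 _.
  by rewrite !mulr_ge0//; case: (delta_distr G s a1 a2).
rewrite /mixed_delta exchange_big/= -s1; apply: eq_bigr => a1 _.
rewrite exchange_big/= -[RHS]mulr1 -s2 mulr_sumr; apply: eq_bigr => a2 _.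
by rewrite -!mulr_suml; case: (delta_distr G s a1 a2) => _ _ ->; rewrite mul1r.
Qed.

(** The only case split on [i]: from here on, an expectation is a sum against some distribution [p],
    whichever player [i] is. *)
Lemma expect_forE s x y : mixed G i s x -> mixed G (opponent i) s y ->
  exists2 p, distr predT p & forall k, expect_for G i s x y k = \sum_v p v * k v.
Proof.
rewrite /expect_for; case: i => mx my.
  by exists (mixed_delta G s x y) => //; exact: mixed_delta_distr mx my.
by exists (mixed_delta G s y x) => //; exact: mixed_delta_distr my mx.
Qed.

Lemma expect_for_leD s x y k k' e :
  mixed G i s x -> mixed G (opponent i) s y ->
  (forall v, k v <= k' v + e) ->
  expect_for G i s x y k <= expect_for G i s x y k' + e.
Proof.
move=> mx my le; have [p [p0 _ p1] E] := expect_forE mx my.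
(* Since [p] has mass 1, the constant [e] is its own expectation and joins the sum. *)
rewrite !E -[e]mul1r -p1 mulr_suml -big_split/=; apply: ler_sum => v _.
by rewrite -mulrDr; apply: ler_wpM2l.
Qed.

Lemma expect_for_itv s x y k :
  mixed G i s x -> mixed G (opponent i) s y -> valuation k ->
  0 <= expect_for G i s x y k <= 1.
Proof.
move=> mx my hk; have [p [p0 _ p1] E] := expect_forE mx my.
rewrite E sumr_ge0 => [|v _]; last by rewrite mulr_ge0//; case/andP: (hk v).
rewrite -p1; apply: ler_sum => v _; rewrite -[leRHS]mulr1.
by apply: ler_wpM2l => //; case/andP: (hk v).
Qed.

Lemma inf_expect_itv s x k : mixed G i s x -> valuation k ->
  0 <= inf [set expect_for G i s x y k | y in mixed G (opponent i) s] <= 1.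
Proof.
move=> mx hk; apply: inf_image_itv; first exact: mixed_neq0.
by move=> y my; exact: expect_for_itv.
Qed.

Lemma Pre_itv k s : valuation k -> 0 <= Pre G i k s <= 1.
Proof.
move=> hk; apply: sup_image_itv; first exact: mixed_neq0.
by move=> x mx; exact: inf_expect_itv.
Qed.

Lemma Pre_leD k k' e s : valuation k -> valuation k' ->
  (forall v, k v <= k' v + e) -> Pre G i k s <= Pre G i k' s + e.
Proof.
move=> hk hk' le; apply: (@sup_image_leD _ _ _ _ _ _ 0 1).
- exact: mixed_neq0.
- by move=> x mx; exact: inf_expect_itv.
move=> x mx; apply: (@inf_image_leD _ _ _ _ _ _ 0 1).
- exact: mixed_neq0.
- by move=> y my; exact: expect_for_itv.
- by move=> y my; exact: expect_for_leD.
Qed.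

(** * Valuations compatible with a directed metric *)

Lemma C_of_zero d : directed_metric d -> C_of d (fun=> 0).
Proof. by case=> p _ _; split=> [s|s t]; rewrite ?lexx ?ler01// subrr. Qed.

Lemma C_of_neq0 d : directed_metric d -> C_of d !=set0.
Proof. by exists (fun=> 0); exact: C_of_zero. Qed.

(** Inf-convolution of [k] with [d']. The triangle inequality puts [k'] in [C_of d'], [d' s s = 0]
    gives [k' <= k], and [k s <= k t + d s t <= k t + d' s t + e] gives the other bound. *)
Lemma C_of_approx d d' e k : directed_metric d' ->
  (forall s t, d s t <= d' s t + e) -> C_of d k ->
  exists2 k', C_of d' k' & forall s, k' s <= k s <= k' s + e.
Proof.
move=> [p z tr] le [vk hk].
pose k' s := inf [set k t + d' s t | t in [set: S]].
have T0 (s : S) : [set: S] !=set0 by exists s.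
(* A crude upper bound, uniform in [t], to serve the lemmas on bounded families. *)
have bd s t : [set: S] t -> 0 <= k t + d' s t <= 1 + \sum_v d' s v.
  move=> _; have /andP[k0 k1] := vk t; rewrite addr_ge0//= lerD//.
  by rewrite (bigD1 t)//= lerDl sumr_ge0.
have k'k s : k' s <= k s.
  have := inf_image_le (bd s) (I : [set: S] s).
  by rewrite z addr0.
exists k'; first split.
- move=> s; apply/andP; split.
    by apply: le_inf_image (T0 s) _ _ _ => t _; case/andP: (bd s t I).
  by apply: le_trans (k'k s) _; case/andP: (vk s).
- move=> s t; rewrite lerBlDr addrC.
  apply: (inf_image_leD (T0 s) (bd s)) => v _.
  by rewrite -addrA lerD2l addrC; exact: tr.
move=> s; rewrite k'k/= -lerBlDr; apply: le_inf_image (T0 s) _ _ _ => t _.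
by have := hk s t; have := le s t; lra.
Qed.

(** * The observation distance *)

Lemma obs_dist_ge0 s t : 0 <= obs_dist G s t.
Proof.
by rewrite /obs_dist; elim/big_ind: _ => // a b a0 b0; rewrite le_max a0.
Qed.

Lemma obs_dist_refl s : obs_dist G s s = 0.
Proof.
rewrite /obs_dist; elim/big_ind: _ => // [a b -> ->|v _]; first by rewrite maxxx.
by rewrite subrr normr0.
Qed.

Lemma obs_dist_le s t c : 0 <= c ->
  (forall v, `|obs G v s - obs G v t| <= c) -> obs_dist G s t <= c.
Proof.
move=> c0 h; rewrite /obs_dist; elim/big_ind: _ => // a b ac bc.
by rewrite ge_max ac.
Qed.

Lemma le_obs_dist s t v : `|obs G v s - obs G v t| <= obs_dist G s t.
Proof. by rewrite /obs_dist (bigD1 v)//= le_max lexx. Qed.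

Lemma obs_dist_le1 s t : obs_dist G s t <= 1.
Proof.
apply: obs_dist_le => // v; rewrite ler_norml.
by have /andP[? ?] := obs_itv G v s; have /andP[? ?] := obs_itv G v t; lra.
Qed.

Lemma obs_dist_triangle s t u :
  obs_dist G s t <= obs_dist G s u + obs_dist G u t.
Proof.
apply: obs_dist_le => [|v]; first by rewrite addr_ge0 ?obs_dist_ge0.
apply: le_trans (ler_distD (obs G v u) _ _) _.
by rewrite lerD ?le_obs_dist.
Qed.

(** The common shape of both transformers. [F] may be negative, hence only [F d s s <= 0] is asked;
    the maximum with [obs_dist] restores nonnegativity and the zero diagonal. *)
Lemma max_obs_dist_bounded_nonexpansive (F : (S -> S -> R) -> S -> S -> R) :
  (forall d, directed_metric d -> forall s, F d s s <= 0) ->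
  (forall d, directed_metric d -> forall s t u, F d s t <= F d s u + F d u t) ->
  (forall d, directed_metric d -> forall s t, F d s t <= 1) ->
  (forall d d' e, directed_metric d -> directed_metric d' ->
     (forall s t, d s t <= d' s t + e) ->
     forall s t, F d s t <= F d' s t + e) ->
  bounded_nonexpansive (fun d s t => Num.max (obs_dist G s t) (F d s t)).
Proof.
move=> F0 Ftr F1 Fn; split.
- move=> d dd; split=> [s t|s|s t u].
  + by rewrite le_max obs_dist_ge0.
  + by rewrite obs_dist_refl; apply/max_idPl; exact: F0.
  + rewrite ge_max; apply/andP; split.
      apply: le_trans (obs_dist_triangle s t u) _.
      by rewrite lerD// le_max lexx.
    by apply: le_trans (Ftr d dd s t u) _; rewrite lerD// le_max lexx orbT.
- by move=> d dd s t; rewrite ge_max obs_dist_le1 F1.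
- move=> d d' e dd dd' e0 le s t; rewrite ge_max; apply/andP; split.
    by rewrite -[leLHS]addr0 lerD// le_max lexx.
  apply: le_trans (Fn d d' e dd dd' le s t) _.
  by rewrite lerD2r le_max lexx orbT.
Qed.

(** * The a priori transformer *)

Lemma H_apriori_bounded_nonexpansive : bounded_nonexpansive (H_apriori G i).
Proof.
have bd d s t k : C_of d k -> -1 <= Pre G i k s - Pre G i k t <= 1.
  move=> [vk _]; have /andP[? ?] := Pre_itv s vk.
  by have /andP[? ?] := Pre_itv t vk; lra.
apply: max_obs_dist_bounded_nonexpansive => d.
- move=> dd s; apply: sup_image_le (C_of_neq0 dd) _ _ _ => k _.
  by rewrite subrr.
- move=> dd s t u; apply: sup_image_le (C_of_neq0 dd) _ _ _ => k Ck.
  (* For a fixed [k] the difference telescopes through [Pre G i k u]. *)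
  have := le_sup_image (bd d s u) Ck; have := le_sup_image (bd d u t) Ck.
  by move=> /= ? ?; lra.
- move=> dd s t; apply: sup_image_le (C_of_neq0 dd) _ _ _ => k Ck.
  by case/andP: (bd d s t k Ck).
- move=> d' e dd dd' le s t; apply: sup_image_le (C_of_neq0 dd) _ _ _ => k Ck.
  (* Passing from [k] to [k'] costs [e] at [s] only: at [t] the subtracted term does not grow, as
     [k' <= k]. *)
  have [k' Ck' kk'] := C_of_approx dd' le Ck.
  have := le_sup_image (bd d' s t) Ck'; have [vk _] := Ck; have [vk' _] := Ck'.
  have : Pre G i k s <= Pre G i k' s + e.
    by apply: Pre_leD => // v; case/andP: (kk' v).
  have : Pre G i k' t <= Pre G i k t + 0.
    by apply: Pre_leD => // v; rewrite addr0; case/andP: (kk' v).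
  by move=> /= ? ? ?; lra.
Qed.

(** * The a posteriori transformer *)

Section Aposteriori.
Variable d : S -> S -> R.

(** This and the next four definitions name the nested [sup] and [inf] of [H_aposteriori] from the
    inside out, so that each level gets its own bounds; the last one is convertible to the whole
    nest. *)
Definition expect_gap s t x y y' x' : R :=
  sup [set expect_for G i s x x' k - expect_for G i t y y' k | k in C_of d].

Definition best_response s t x y y' : R :=
  inf [set expect_gap s t x y y' x' | x' in mixed G (opponent i) s].

Definition worst_challenge s t x y : R :=
  sup [set best_response s t x y y' | y' in mixed G (opponent i) t].

Definition best_match s t x : R :=
  inf [set worst_challenge s t x y | y in mixed G i t].

Definition aposteriori_gap s t : R :=
  sup [set best_match s t x | x in mixed G i s].

Hypothesis dd : directed_metric d.

Lemma expect_diff_itv s t x y y' x' k : C_of d k ->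
  mixed G i s x -> mixed G i t y -> mixed G (opponent i) t y' ->
  mixed G (opponent i) s x' ->
  -1 <= expect_for G i s x x' k - expect_for G i t y y' k <= 1.
Proof.
move=> [vk _] mx my my' mx'.
have /andP[? ?] := expect_for_itv mx mx' vk.
by have /andP[? ?] := expect_for_itv my my' vk; lra.
Qed.

Lemma expect_gap_itv s t x y y' x' :
  mixed G i s x -> mixed G i t y -> mixed G (opponent i) t y' ->
  mixed G (opponent i) s x' -> -1 <= expect_gap s t x y y' x' <= 1.
Proof.
move=> *; apply: sup_image_itv (C_of_neq0 dd) _ _ _ _ => k Ck.
exact: expect_diff_itv.
Qed.

Lemma best_response_itv s t x y y' :
  mixed G i s x -> mixed G i t y -> mixed G (opponent i) t y' ->
  -1 <= best_response s t x y y' <= 1.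
Proof.
move=> *; apply: inf_image_itv (mixed_neq0 _ _) _ _ _ _ => x' mx'.
exact: expect_gap_itv.
Qed.

Lemma worst_challenge_itv s t x y :
  mixed G i s x -> mixed G i t y -> -1 <= worst_challenge s t x y <= 1.
Proof.
move=> *; apply: sup_image_itv (mixed_neq0 _ _) _ _ _ _ => y' my'.
exact: best_response_itv.
Qed.

Lemma best_match_itv s t x : mixed G i s x -> -1 <= best_match s t x <= 1.
Proof.
move=> *; apply: inf_image_itv (mixed_neq0 _ _) _ _ _ _ => y my.
exact: worst_challenge_itv.
Qed.

Lemma aposteriori_gap_le1 s t : aposteriori_gap s t <= 1.
Proof.
apply: sup_image_le (mixed_neq0 _ _) _ _ _ => x mx.
by case/andP: (best_match_itv t mx).
Qed.

(** For each [k] the difference telescopes through the expectation at [u] under [z] and [z']. *)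
Lemma expect_gap_triangle s u t x x' z z' y y' :
  mixed G i s x -> mixed G (opponent i) s x' ->
  mixed G i u z -> mixed G (opponent i) u z' ->
  mixed G i t y -> mixed G (opponent i) t y' ->
  expect_gap s t x y y' x' <= expect_gap s u x z z' x' + expect_gap u t z y y' z'.
Proof.
move=> mx mx' mz mz' my my'; apply: sup_image_le (C_of_neq0 dd) _ _ _ => k Ck.
have := le_sup_image (A := C_of _) (fun k Ck => expect_diff_itv Ck mx mz mz' mx') Ck.
have := le_sup_image (A := C_of _) (fun k Ck => expect_diff_itv Ck mz my my' mz') Ck.
by rewrite -/(expect_gap _ _ _ _ _ _) -/(expect_gap _ _ _ _ _ _) => ? ?; lra.
Qed.

(* The simulating player copies the move and the response of the simulated
   one. *)
Lemma aposteriori_gap_refl s : aposteriori_gap s s <= 0.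
Proof.
apply: sup_image_le (mixed_neq0 _ _) _ _ _ => x mx.
apply: le_trans (inf_image_le (fun y my => worst_challenge_itv mx my) mx) _.
apply: sup_image_le (mixed_neq0 _ _) _ _ _ => x' mx'.
apply: le_trans (inf_image_le (fun z mz => expect_gap_itv mx mx mx' mz) mx') _.
by apply: sup_image_le (C_of_neq0 dd) _ _ _ => k _; rewrite subrr.
Qed.

(* Player [i] forwards moves s -> u -> t and the opponent forwards responses
   t -> u -> s, each up to [e]. *)
Lemma aposteriori_gap_triangle s t u :
  aposteriori_gap s t <= aposteriori_gap s u + aposteriori_gap u t.
Proof.
apply: sup_image_le (mixed_neq0 _ _) _ _ _ => x mx.
(* Infima need not be attained here: each of the four choices [z], [y], [z'], [x'] loses up to
   [e]. *)
apply/ler_addgt0Pr => e' e'0; pose e := e' / 4.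
have e0 : 0 < e by rewrite divr_gt0.
have {e'0} -> : e' = e + e + e + e by rewrite /e; lra.
have [z mz hz] := inf_image_adherent (mixed_neq0 i u)
  (fun y my => worst_challenge_itv mx my) e0.
have [y my hy] := inf_image_adherent (mixed_neq0 i t)
  (fun y my => worst_challenge_itv mz my) e0.
have hx1 := le_sup_image (A := mixed _ _ _) (fun x mx => best_match_itv u mx) mx.
have hz1 := le_sup_image (A := mixed _ _ _) (fun x mx => best_match_itv t mx) mz.
apply: le_trans (inf_image_le (fun y my => worst_challenge_itv mx my) my) _.
apply: sup_image_le (mixed_neq0 _ _) _ _ _ => y' my'.
(* Responses are chosen backwards: [z'] at [u] answers [y'], then [x'] at [s] answers [z']. *)
have [z' mz' hz'] := inf_image_adherent (mixed_neq0 (opponent i) u)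
  (fun z' mz' => expect_gap_itv mz my my' mz') e0.
have [x' mx' hx'] := inf_image_adherent (mixed_neq0 (opponent i) s)
  (fun x' mx' => expect_gap_itv mx mz mz' mx') e0.
have hy2 := le_sup_image (A := mixed _ _ _) (fun y' my' => best_response_itv mz my my') my'.
have hz2 := le_sup_image (A := mixed _ _ _) (fun z' mz' => best_response_itv mx mz mz') mz'.
apply: le_trans (inf_image_le (fun z mz => expect_gap_itv mx my my' mz) mx') _.
apply: le_trans (expect_gap_triangle mx mx' mz mz' my my') _.
(* Folding the nested bounds back into their names makes the inequalities share atoms, and chaining
   them is then linear. *)
move: hz hy hx1 hz1 hz' hx' hy2 hz2.
rewrite -/(best_match s u x) -/(best_match u t z).
rewrite -/(aposteriori_gap s u) -/(aposteriori_gap u t).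
rewrite -/(best_response u t z y y') -/(best_response s u x z z').
rewrite -/(worst_challenge u t z y) -/(worst_challenge s u x z).
by move=> *; lra.
Qed.

End Aposteriori.

(** The four outer levels range over sets independent of [d], so they pass [e] through; only the
    innermost [sup] over [C_of d] needs [k] replaced by [k']. *)
Lemma aposteriori_gap_leD d d' e : directed_metric d -> directed_metric d' ->
  (forall s t, d s t <= d' s t + e) ->
  forall s t, aposteriori_gap d s t <= aposteriori_gap d' s t + e.
Proof.
move=> dd dd' le s t.
apply: sup_image_leD (mixed_neq0 _ _) _ _ _ _ _
  (fun x mx => best_match_itv dd' t mx) _ => x mx.
apply: inf_image_leD (mixed_neq0 _ _) _ _ _ _ _
  (fun y my => worst_challenge_itv dd mx my) _ => y my.
apply: sup_image_leD (mixed_neq0 _ _) _ _ _ _ _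
  (fun y' my' => best_response_itv dd' mx my my') _ => y' my'.
apply: inf_image_leD (mixed_neq0 _ _) _ _ _ _ _
  (fun x' mx' => expect_gap_itv dd mx my my' mx') _ => x' mx'.
apply: sup_image_le (C_of_neq0 dd) _ _ _ => k Ck.
have [k' Ck' kk'] := C_of_approx dd' le Ck.
have := le_sup_image (A := C_of _) (fun k Ck => expect_diff_itv Ck mx my my' mx') Ck'.
rewrite -/(expect_gap _ _ _ _ _ _ _).
have : expect_for G i s x x' k <= expect_for G i s x x' k' + e.
  by apply: expect_for_leD => // v; case/andP: (kk' v).
have : expect_for G i t y y' k' <= expect_for G i t y y' k + 0.
  by apply: expect_for_leD => // v; rewrite addr0; case/andP: (kk' v).
by move=> *; lra.
Qed.

Lemma H_aposteriori_bounded_nonexpansive :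
  bounded_nonexpansive (H_aposteriori G i).
Proof.
apply: (max_obs_dist_bounded_nonexpansive aposteriori_gap_refl
  aposteriori_gap_triangle aposteriori_gap_le1 aposteriori_gap_leD).
Qed.

End GameTransformers.

Theorem theorem3p5 (R : realType) (S V Moves : finType)
    (G : game_structure R S V Moves) (i : player) :
  [/\ is_least_fixpoint (H_apriori G i) (apriori_sim G i) /\
      pointwise_limit (iterates (H_apriori G i)) (apriori_sim G i),
      is_least_fixpoint (H_aposteriori G i) (aposteriori_sim G i) /\
      pointwise_limit (iterates (H_aposteriori G i)) (aposteriori_sim G i),
      is_least_fixpoint (symmetrize (H_apriori G i)) (apriori_bisim G i) /\
      pointwise_limit (iterates (symmetrize (H_apriori G i)))
        (apriori_bisim G i) &
      is_least_fixpoint (symmetrize (H_aposteriori G i))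
        (aposteriori_bisim G i) /\
      pointwise_limit (iterates (symmetrize (H_aposteriori G i)))
        (aposteriori_bisim G i)].
Proof.
have h1 := H_apriori_bounded_nonexpansive G i.
have h2 := H_aposteriori_bounded_nonexpansive G i.
split; apply: iterates_cvg_least_fixpoint => //;
  exact: symmetrize_bounded_nonexpansive.
Qed.
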